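(* Let $E$ be a directed graph and $X\subseteq E^0$. If $H_E(X)\setminus X$ is finite, then there is a row-finite, path-finite directed subtree $T$ of $E$ with $T^r=X$ and $T^0=H_E(X)$. If $X$ is finite and $H_E(X)$ is infinite, then there is no row-finite, path-finite directed subtree $T$ of $E$ with $T^r=X$ and $T^0=H_E(X)$.
   Context: A directed graph $E=(E^0,E^1,s,r)$ consists of a vertex set $E^0$, an edge set $E^1$, and source and range maps $s,r:E^1\to E^0$. Finite paths are $\mu=\mu_1\cdots\mu_n$ with $r(\mu_i)=s(\mu_{i+1})$; vertices are paths of length $0$. Infinite paths are right-, left- or bi-infinite sequences of composable edges. A path (finite or infinite) is vertex-simple if its sequence of vertices contains no repetition; paths of length $0$ are vertex-simple. A graph is row-finite if each vertex emits finitely many edges, acyclic if all its finite and infinite paths are vertex-simple, and path-finite if it has no vertex-simple infinite path. For $u,v\in E^0$, $u\ge_Ev$ means there is a finite path in $E$ from $u$ to $v$. A set $Y\subseteq E^0$ is hereditary if $v\in Y$ and $v\ge_E u$ imply $u\in Y$; $H_E(X)$ is the smallest hereditary subset of $E^0$ containing $X$. A directed subtree of $E$ is an acyclic subgraph $T$ such that every $v\in T^0$ satisfies $|T^1\cap r^{-1}(v)|\le1$. Its set of roots is $T^r=\{v\in T^0:|T^1\cap r^{-1}(v)|=0\}$. *)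

(* Defs.v *)
From mathcomp Require Import all_boot ssralg ssrint.
From mathcomp Require Import boolp classical_sets functions cardinality.

Set Implicit Arguments.
Unset Strict Implicit.
Unset Printing Implicit Defensive.

Local Open Scope classical_set_scope.
Local Open Scope card_scope.

Record digraph := Digraph {
  vertex : Type;
  edge : Type;
  src : edge -> vertex;
  rng : edge -> vertex
}.

Section Graphs.
Variable E : digraph.

(* The finite paths of E are the pairs (u, p) with composable u p, where u is
   the initial vertex; (u, [::]) is the path of length 0 at u. *)
Fixpoint composable (u : vertex E) (p : seq (edge E)) : Prop :=
  if p is e :: q then src e = u /\ composable (rng e) q else True.

Definition vertex_seq (u : vertex E) (p : seq (edge E)) : seq (vertex E) :=
  u :: [seq rng e | e <- p].

(* LeftInf f is the path ... (f 2) (f 1) (f 0), whose last vertex is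
   rng (f 0). *)
Inductive gpath :=
| FinPath (u : vertex E) (p : seq (edge E)) of composable u p
| RightInf (f : nat -> edge E) of (forall i, rng (f i) = src (f i.+1))
| LeftInf (f : nat -> edge E) of (forall i, rng (f i.+1) = src (f i))
| BiInf (f : int -> edge E) of (forall i, rng (f i) = src (f (i + 1)%R)).

Definition infinite_path (mu : gpath) : bool :=
  if mu is FinPath _ _ _ then false else true.

(* {classic V} is V with the decidable equality given by classical logic. *)
Definition vertex_simple (mu : gpath) : Prop :=
  match mu with
  | FinPath u p _ => uniq (vertex_seq u p : seq {classic (vertex E)})
  | RightInf f _ => injective (fun i => src (f i))
  | LeftInf f _ => injective (fun i => rng (f i))
  | BiInf f _ => injective (fun i => src (f i))
  end.

Definition row_finite : Prop :=
  forall v : vertex E, finite_set [set e : edge E | src e = v].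

Definition acyclic : Prop := forall mu : gpath, vertex_simple mu.

Definition path_finite : Prop :=
  ~ exists mu : gpath, infinite_path mu /\ vertex_simple mu.

Definition reaches (u v : vertex E) : Prop :=
  exists p : seq (edge E), composable u p /\ last u [seq rng e | e <- p] = v.

Definition hereditary (Y : set (vertex E)) : Prop :=
  forall v u : vertex E, Y v -> reaches v u -> Y u.

Definition hereditary_hull (X : set (vertex E)) : set (vertex E) :=
  smallest hereditary X.

Record subgraph := Subgraph {
  sub_vertex : set (vertex E);
  sub_edge : set (edge E);
  sub_src : forall e, sub_edge e -> sub_vertex (src e);
  sub_rng : forall e, sub_edge e -> sub_vertex (rng e)
}.

Definition in_edges (T : subgraph) (v : vertex E) : set (edge E) :=
  sub_edge T `&` @rng E @^-1` [set v].

Definition tree_roots (T : subgraph) : set (vertex E) :=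
  [set v | sub_vertex T v /\ in_edges T v #= `I_0].

End Graphs.

Definition graph_of_subgraph (E : digraph) (T : subgraph E) : digraph :=
  @Digraph (set_type (sub_vertex T)) (set_type (sub_edge T))
    (fun e => exist _ (src (sval e)) (mem_set (sub_src (set_mem (svalP e)))))
    (fun e => exist _ (rng (sval e)) (mem_set (sub_rng (set_mem (svalP e))))).

Coercion graph_of_subgraph : subgraph >-> digraph.

Definition directed_subtree (E : digraph) (T : subgraph E) : Prop :=
  acyclic T /\ forall v, sub_vertex T v -> in_edges T v #<= `I_1.

(* Main.v *)
Require Import Defs.
From mathcomp Require Import all_boot.
From mathcomp Require Import classical_sets cardinality.
From mathcomp Require Import ssrint boolp.

(** Existence.  The hull of X is the union of the layers obtained from X by
    following edges forward, so every vertex of the hull has a rank, the index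
    of the first layer that contains it.  A vertex of the hull outside X
    receives an edge from a vertex of smaller rank ([hull_rank]).  Keep exactly
    one such edge, its parent edge, for each vertex of H(X) \ X: every vertex
    then receives at most one edge and those that receive none are the elements
    of X.  Row-finiteness holds because only finitely many edges were kept.
    Since ranks strictly increase along edges, no vertex repeats on a finite
    path, and no path goes back forever; one going forward forever would use
    infinitely many edges ([ranked_finite_acyclic_path_finite]).

    Nonexistence.  In an acyclic path-finite graph there are no infinite paths
    at all, vertex-simple or not, so the relation between consecutive edges is
    well-founded in both directions.  Induction in one direction is König's
    lemma: with row-finiteness, each vertex has finitely many descendants
    ([finite_descendants]).  Induction in the other shows that each vertex
    descends from a vertex that receives no edge ([reached_from_source]).
    Hence a row-finite, path-finite acyclic subgraph with finitely many roots
    has finitely many vertices ([finite_vertices_of_finite_roots]). *)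

Set Implicit Arguments.
Unset Strict Implicit.
Unset Printing Implicit Defensive.

Local Open Scope classical_set_scope.

(** * Infinite paths *)

(** Dependent choice, in the form that turns the absence of infinite paths into
    an induction principle. *)
Lemma no_chain_wf (A : Type) (R : A -> A -> Prop) :
  (~ exists f : nat -> A, forall i, R (f i.+1) (f i)) -> well_founded R.
Proof.
move=> nochain a; apply: contrapT => nAcc_a.
have step (x : {x | ~ Acc R x}) : exists y : {x | ~ Acc R x},
    R (sval y) (sval x).
  case: x => x nAcc_x /=; apply: contrapT => noy; apply: nAcc_x.
  constructor=> y Ryx; apply: contrapT => nAcc_y.
  by apply: noy; exists (exist _ y nAcc_y).
have [g gP] := choice step.
apply: nochain; exists (fun n => sval (iter n g (exist _ a nAcc_a))) => i.
exact: gP.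
Qed.

Section InfinitePaths.
Variable G : digraph.

Definition no_right_ray :=
  ~ exists f : nat -> edge G, forall i, rng (f i) = src (f i.+1).

Definition no_left_ray :=
  ~ exists f : nat -> edge G, forall i, rng (f i.+1) = src (f i).

(** A bi-infinite path contains a right-infinite one, so only the one-sided
    paths have to be excluded. *)
Lemma no_ray_no_infinite_path (mu : gpath G) :
  no_right_ray -> no_left_ray -> infinite_path mu = false.
Proof.
move=> noR noL; case: mu => [//|f fP|f fP|f fP].
- by case: noR; exists f.
- by case: noL; exists f.
- case: noR; exists (fun n => f (Posz n)) => i.
  by rewrite fP -addn1 PoszD.
Qed.

Lemma acyclic_path_finite_no_right_ray :
  acyclic G -> path_finite G -> no_right_ray.
Proof.
by move=> acG pfG [f fP]; apply: pfG; exists (RightInf fP); split=> //; apply: acG.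
Qed.

Lemma acyclic_path_finite_no_left_ray :
  acyclic G -> path_finite G -> no_left_ray.
Proof.
by move=> acG pfG [f fP]; apply: pfG; exists (LeftInf fP); split=> //; apply: acG.
Qed.

Variable d : vertex G -> nat.
Hypothesis d_incr : forall e : edge G, d (src e) < d (rng e).

Lemma ranked_composable_path (u : vertex G) (p : seq (edge G)) :
  composable u p -> path ltn (d u) [seq d (rng e) | e <- p].
Proof.
elim: p u => //= e p IHp u [<- cp].
by rewrite d_incr; apply: IHp.
Qed.

(** Going back along a path, natural-number ranks cannot decrease forever. *)
Lemma ranked_no_left_ray : no_left_ray.
Proof.
move=> [f fP].
have drop i : d (rng (f i)) + i <= d (rng (f 0)).
  elim: i => [|i IHi]; first by rewrite addn0.
  by apply: leq_trans IHi; rewrite addnS -addSn leq_add2r fP d_incr.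
have := drop (d (rng (f 0))).+1.
by rewrite leqNgt addnS ltnS leq_addl.
Qed.

(** The sources along a right-infinite path have increasing ranks, so its edges
    are pairwise distinct. *)
Lemma ranked_finite_no_right_ray : finite_set [set: edge G] -> no_right_ray.
Proof.
move=> finG [f fP].
have incr : {homo (fun i => d (src (f i))) : i j / i < j}.
  by apply: homo_ltn => [|i]; [exact: ltn_trans | rewrite -fP d_incr].
have f_inj : injective f.
  move=> i j fij; case: (ltngtP i j) => // /incr; by rewrite fij ltnn.
apply: infinite_nat; apply: (@finite_preimage _ _ setT f) finG.
by move=> i j _ _; apply: f_inj.
Qed.

(** With all infinite paths excluded, acyclicity only concerns the finite ones,
    on which the strictly increasing ranks prevent repetition. *)
Lemma ranked_finite_acyclic_path_finite :
  finite_set [set: edge G] -> acyclic G /\ path_finite G.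
Proof.
move=> finG.
have noinf (mu : gpath G) : infinite_path mu = false.
  apply: (no_ray_no_infinite_path mu); last exact: ranked_no_left_ray.
  exact: ranked_finite_no_right_ray.
split; last by move=> [mu [infmu _]]; rewrite noinf in infmu.
move=> mu; have {noinf} := noinf mu; case: mu => // u p cp _.
apply: (@map_uniq {classic (vertex G)} nat d (vertex_seq u p)).
apply: (@sorted_uniq _ ltn ltn_trans ltnn).
by have := @ranked_composable_path u p cp; rewrite /= -map_comp.
Qed.

End InfinitePaths.

(** * Descendants and ancestors *)

Section Reachability.
Variable G : digraph.

Lemma reaches_refl (v : vertex G) : reaches v v.
Proof. by exists [::]. Qed.

Lemma reaches_src (e : edge G) (v : vertex G) :
  reaches (rng e) v -> reaches (src e) v.
Proof. by move=> [p [cp pv]]; exists (e :: p). Qed.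

Lemma reaches_rng (u : vertex G) (e : edge G) :
  reaches u (src e) -> reaches u (rng e).
Proof.
move=> [p [cp pe]]; exists (rcons p e); split; last first.
  by rewrite map_rcons last_rcons.
elim: p u cp pe => /= [u _ ->//|e' p IHp u [<- cp] pe].
by split=> //; apply: IHp.
Qed.

Lemma reaches_step (u v : vertex G) :
  reaches u v -> u = v \/ exists2 e : edge G, src e = u & reaches (rng e) v.
Proof.
move=> [[|e p] [/= cp pv]]; [by left | right].
by case: cp => su cp; exists e => //; exists p.
Qed.

(** König's lemma.  The descendants of u are u itself and those of the ranges of
    the finitely many edges that u emits; the induction is on edges, ordered so
    that an edge comes after those that can follow it on a path. *)
Lemma finite_descendants (v : vertex G) :
  row_finite G -> no_right_ray G -> finite_set [set w | reaches v w].
Proof.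
move=> rf nor.
have fin_step u :
    (forall e : edge G, src e = u -> finite_set [set w | reaches (rng e) w]) ->
    finite_set [set w | reaches u w].
  move=> fin_rng.
  apply: (@sub_finite_set _ _ ([set u] `|`
    \bigcup_(e in [set e : edge G | src e = u]) [set w | reaches (rng e) w])).
    move=> w /= /reaches_step[->|[e eu ew]]; first by left.
    by right; exists e.
  by rewrite finite_setU; split; [exact: finite_set1 | apply: bigcup_finite].
have wf : well_founded (fun e' e : edge G => rng e = src e').
  by apply: no_chain_wf => -[f fP]; apply: nor; exists f.
have fin_rng (e : edge G) : finite_set [set w | reaches (rng e) w].
  by elim/(well_founded_ind wf): e => e IHe; apply: fin_step => e' /esym/IHe.
exact: fin_step.
Qed.

(** Walking backward from v must stop, and it can only stop at a vertex that
    receives no edge. *)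
Lemma reached_from_source (v : vertex G) :
  no_left_ray G ->
  exists2 r : vertex G, (forall e : edge G, rng e <> r) & reaches r v.
Proof.
move=> nol.
have wf : well_founded (fun e' e : edge G => rng e' = src e).
  by apply: no_chain_wf => -[f fP]; apply: nol; exists f.
have src_step u :
    (forall e : edge G, rng e = u -> exists2 r : vertex G,
       (forall e : edge G, rng e <> r) & reaches r (src e)) ->
    exists2 r : vertex G, (forall e : edge G, rng e <> r) & reaches r u.
  move=> IHu; have [[e eu]|noe] := pselect (exists e : edge G, rng e = u).
    have [r rP re] := IHu e eu.
    by exists r => //; rewrite -eu; apply: reaches_rng.
  exists u; last exact: reaches_refl.
  by move=> e eu; apply: noe; exists e.
have src_ind (e : edge G) : exists2 r : vertex G,
    (forall e : edge G, rng e <> r) & reaches r (src e).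
  by elim/(well_founded_ind wf): e => e IHe; apply: src_step => e' /IHe.
exact: src_step.
Qed.

End Reachability.

(** * The hereditary hull and its parent edges *)

Lemma finite_set_type (T : Type) (A : set T) :
  finite_set A -> finite_set [set: A].
Proof. by rewrite (eq_finite_set (card_setT A)). Qed.

Section Hull.
Variables (E : digraph) (X : set (vertex E)).

Fixpoint layer (n : nat) : set (vertex E) :=
  if n is m.+1 then [set rng e | e in @src E @^-1` layer m] else X.

Lemma hereditary_hull_hereditary : hereditary (hereditary_hull X).
Proof.
move=> v u Hv vu Y YP; have [hY _] := YP.
by apply: (hY v) => //; apply: Hv.
Qed.

Lemma hereditary_hullE : hereditary_hull X = \bigcup_n layer n.
Proof.
apply/seteqP; split.
  apply: smallest_sub; last by move=> x Xx; exists 0.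
  move=> v u [n _ Lv] [p [cp <-]].
  elim: p n v Lv cp => [|e p IHp] n v Lv /=; first by exists n.
  move=> [ev cp]; apply: (IHp n.+1) => //=.
  by exists e => //=; rewrite ev.
move=> v [n _]; elim: n v => [|n IHn] v /=; first exact: sub_gen_smallest.
move=> [e /IHn He <-].
apply: hereditary_hull_hereditary He _.
exact: reaches_src (reaches_refl _).
Qed.

(** The rank d v is the index of the first layer containing v; a vertex outside X
    is not in layer 0, so it enters its layer through an edge from the
    preceding one.  Only the decrease matters later, so the layers are hidden
    from the statement. *)
Lemma hull_rank :
  exists d : vertex E -> nat, forall v, (hereditary_hull X `\` X) v ->
    exists e : edge E, [/\ rng e = v, hereditary_hull X (src e) &
                           d (src e) < d v].
Proof.
(* The value 0 outside the hull is arbitrary. *)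
have least v : exists n, hereditary_hull X v ->
    layer n v /\ forall m, layer m v -> n <= m.
  have [|nHv] := pselect (hereditary_hull X v); last by exists 0.
  rewrite hereditary_hullE => -[n _ Ln].
  have exL : exists n, `[< layer n v >] by exists n; apply/asboolP.
  case: (ex_minnP exL) => m /asboolP Lm mmin.
  by exists m => _; split=> // k Lk; apply: mmin; apply/asboolP.
have [d dP] := choice least.
exists d => v [Hv nXv]; have [] := dP v Hv.
case dv: (d v) => [//|n] /= [e Le ev] _.
have He : hereditary_hull X (src e) by rewrite hereditary_hullE; exists n.
by exists e; split=> //; have [_ /(_ _ Le)] := dP _ He.
Qed.

End Hull.

(** * The two halves *)

(** The tree consists of the hull together with one parent edge for each vertex
    of the hull outside X. *)
Lemma exists_path_finite_subtree (E : digraph) (X : set (vertex E)) :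
  finite_set (hereditary_hull X `\` X) ->
  exists T : subgraph E,
    [/\ directed_subtree T, row_finite T, path_finite T,
        tree_roots T = X & sub_vertex T = hereditary_hull X].
Proof.
set H := hereditary_hull X => finHX.
have [d dP] := @hull_rank E X.
have [parent parentP] := choice (fun v : (H `\` X) => dP (sval v) (set_valP v)).
have parent_src e : range parent e -> H (src e).
  by move=> [v _ <-]; case: (parentP v).
have parent_rng e : range parent e -> H (rng e).
  by move=> [v _ <-]; case: (parentP v) => ->; case: (set_valP v).
pose T := Subgraph parent_src parent_rng.
have finE : finite_set (range parent).
  by apply: finite_image; apply: finite_set_type.
have finTE : finite_set [set: edge T] by apply: finite_set_type.
have rankT (e : edge T) : d (sval (src e)) < d (sval (rng e)).
  by case: e => e /= /set_mem[v _ <-]; case: (parentP v) => ->.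
have [acT pfT] := @ranked_finite_acyclic_path_finite T (d \o sval) rankT finTE.
have in_edge v e :
    in_edges T v e -> exists2 w : (H `\` X), sval w = v & parent w = e.
  move=> [[w _ <-] /=]; case: (parentP w) => -> _ _ wv.
  by exists w.
have in_edges0 v : H v -> (in_edges T v = set0) = X v.
  move=> Hv; rewrite propeqE; split=> [in0|Xv].
    apply: contrapT => nXv; pose w : (H `\` X) := SigSub (mem_set (conj Hv nXv)).
    suff : in_edges T v (parent w) by rewrite in0.
    by split; [exists w | case: (parentP w)].
  rewrite -subset0 => e /in_edge[w wv _].
  by have [_ nXw] := set_valP w; apply: nXw; rewrite -wv in Xv; apply: Xv.
exists T; split=> //.
- split=> // v _.
  have [[e /in_edge[w wv we]]|noe] := pselect (exists e, in_edges T v e).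
    rewrite -(card_le_eqr (card_set1 (x := e))); apply: subset_card_le => e'.
    move=> /in_edge[w' w'v <-]; rewrite /= -we; congr parent.
    by apply: val_inj; rewrite /= w'v.
  suff -> : in_edges T v = set0 by apply: card_ge0.
  by rewrite -subset0 => e ve; apply: noe; exists e.
- by move=> v; apply: sub_finite_set finTE.
- apply/seteqP; split=> v; rewrite /tree_roots /= II0 card_eq0.
    by move=> [Hv /eqP]; rewrite in_edges0.
  move=> Xv; have Hv : H v by apply: sub_gen_smallest.
  by split=> //; apply/eqP; rewrite in_edges0.
Qed.

(** The vertices are the descendants of the finitely many roots, and each root
    has only finitely many descendants. *)
Lemma finite_vertices_of_finite_roots (E : digraph) (T : subgraph E) :
  acyclic T -> row_finite T -> path_finite T ->
  finite_set (tree_roots T) -> finite_set (sub_vertex T).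
Proof.
move=> acT rfT pfT finR.
have noR := acyclic_path_finite_no_right_ray acT pfT.
have noL := acyclic_path_finite_no_left_ray acT pfT.
pose root_in := [set r : vertex T | tree_roots T (sval r)].
have fin_root : finite_set root_in.
  by apply: finite_preimage finR => r r' _ _; apply: val_inj.
have finD : finite_set (\bigcup_(r in root_in) [set w : vertex T | reaches r w]).
  by apply: bigcup_finite => // r _; apply: finite_descendants.
apply: sub_finite_set (finite_image (fun w : vertex T => sval w) finD).
move=> v Tv; pose w : vertex T := SigSub (mem_set Tv).
have [r rP rw] := reached_from_source w noL.
exists w => //; exists r => //; split; first exact: set_valP r.
rewrite II0 card_eq0; apply/eqP; rewrite -subset0 => e [Te er].
by apply: (rP (SigSub (mem_set Te))); apply: val_inj.
Qed.

Theorem lemma3p6 (E : digraph) (X : set (vertex E)) :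
  (finite_set (hereditary_hull X `\` X) ->
     exists T : subgraph E,
       [/\ directed_subtree T, row_finite T, path_finite T,
           tree_roots T = X & sub_vertex T = hereditary_hull X]) /\
  (finite_set X -> infinite_set (hereditary_hull X) ->
     ~ exists T : subgraph E,
         [/\ directed_subtree T, row_finite T, path_finite T,
             tree_roots T = X & sub_vertex T = hereditary_hull X]).
Proof.
split; first exact: exists_path_finite_subtree.
move=> finX infH [T [[acT _] rfT pfT rootsT vertT]]; apply: infH.
by rewrite -vertT; apply: finite_vertices_of_finite_roots => //; rewrite rootsT.
Qed.
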